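(* Let $n\ge 1$ be an integer, $N=2n+1$, and let $H_N\mathbb{R}$ be the classical Heisenberg group of dimension $N$ with the left-invariant coframe $\{\theta^1,\dots,\theta^N\}$ described in the context. If $g_0$ is a diagonal left-invariant metric on $H_N\mathbb{R}$, then the solution $g(t) = \sum_{I=1}^N g_I(t)\,\theta^I\otimes\theta^I$, $t\in[0,\infty)$, of Ricci flow with $g(0)=g_0$ has the following asymptotic behavior as $t\to\infty$: for $1\le i\le n$, $$ g_i(t) \sim (n+2)^{\frac{1}{n+2}}\sqrt{A_i}\;C^{\frac{1}{2(n+2)}}\;t^{\frac{1}{n+2}}, $$ $$ g_{i+n}(t) \sim (n+2)^{\frac{1}{n+2}}\sqrt{B_{i+n}}\;C^{\frac{1}{2(n+2)}}\;t^{\frac{1}{n+2}}, $$ $$ g_N(t) \sim (n+2)^{-\frac{n}{n+2}}\;C^{\frac{1}{n+2}}\;t^{-\frac{n}{n+2}}, $$ where $$ A_i = \frac{g_i(0)}{g_{i+n}(0)}, \qquad B_{i+n} = \frac{g_{i+n}(0)}{g_i(0)}, \qquad C = g_1(0)\cdots g_{2n}(0)\,g_N(0)^2 . $$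
   Context: The group $H_N\mathbb{R} \subset \mathrm{SL}_{n+2}\mathbb{R}$ consists of the real $(n+2)\times(n+2)$ matrices $\begin{pmatrix} 1 & a^T & c \\ 0 & I_n & b \\ 0 & 0 & 1\end{pmatrix}$ with $a,b\in\mathbb{R}^n$, $c\in\mathbb{R}$, under matrix multiplication. The global coordinates are $(x^1,\dots,x^n) = a$, $(x^{1+n},\dots,x^{2n}) = b$, $x^N = c$. The left-invariant coframe is $$\theta^i = dx^i,\qquad \theta^{i+n} = dx^{i+n} \quad (1\le i\le n), \qquad \theta^N = dx^N - \sum_{k=1}^n x^k\,dx^{k+n}.$$ A left-invariant metric $g = \sum_{I,J} g_{IJ}\,\theta^I\otimes\theta^J$ (constant coefficients) is diagonal if $g_{IJ}=0$ for $I\neq J$; one then writes $g_I = g_{II}$. A Ricci flow solution is a one-parameter family of metrics with $\frac{d}{dt} g = -2\,\mathrm{Rc}(g)$; solutions starting at a left-invariant metric are understood to be left-invariant, and diagonality is preserved by the flow. For functions of $t$, $a(t)\sim b(t)$ means $\lim_{t\to\infty} a(t)/b(t) = 1$. *)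

(* Defs.v *)
From HB Require Import structures.
From mathcomp Require Import all_boot all_order all_algebra.
From mathcomp Require Import all_classical all_reals all_analysis.
Set Implicit Arguments.
Unset Strict Implicit.
Unset Printing Implicit Defensive.
Import Order.TTheory GRing.Theory Num.Theory.
Import numFieldNormedType.Exports.
Local Open Scope classical_set_scope.
Local Open Scope ring_scope.

(* Riemannian geometry of R^d in its global coordinates.  A point is a row
   vector, and a field of bilinear forms is a map h : 'rV[R]_d -> 'M[R]_d, with
   h x i j the component along dx^i (x) dx^j. *)
Section Coordinates.
Variables (R : realType) (d : nat).
Implicit Types (h : 'rV[R]_d -> 'M[R]_d) (x : 'rV[R]_d).

Definition partial (k : 'I_d) (f : 'rV[R]_d -> R) x : R :=
  'D_(delta_mx 0 k) f x.

Definition is_metric_mx (G : 'M[R]_d) : Prop :=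
  G^T = G /\ forall v : 'rV[R]_d, v != 0 -> 0 < (v *m G *m v^T) 0 0.

(* Gamma^k_ij of the Levi-Civita connection *)
Definition christoffel h (k i j : 'I_d) x : R :=
  2^-1 * \sum_l invmx (h x) k l *
    (partial i (fun y => h y j l) x + partial j (fun y => h y i l) x
     - partial l (fun y => h y i j) x).

(* Rc(Y, Z) = tr (X |-> Rm(X, Y) Z), with the sign convention
   Rm(X, Y) = [nabla_X, nabla_Y] - nabla_[X, Y], so that round spheres have
   positive Ricci curvature. *)
Definition ricci h x : 'M[R]_d := \matrix_(i, j)
  (\sum_k (partial k (christoffel h k i j) x
           - partial j (christoffel h k i k) x)
   + \sum_k \sum_l (christoffel h k k l x * christoffel h l i j x
                    - christoffel h k j l x * christoffel h l i k x)).

(* The derivative of f at t relative to [0, +oo[: two-sided for t > 0,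
   one-sided at t = 0. *)
Definition has_deriv_ge0 (f : R -> R) (t l : R) : Prop :=
  (fun s => (f s - f t) / (s - t)) @ within [set s | 0 <= s] t^' --> l.

Definition ricci_flow (h : R -> 'rV[R]_d -> 'M[R]_d) : Prop :=
  forall t, 0 <= t -> forall x i j,
    has_deriv_ge0 (fun s => h s x i j) t (- 2 * ricci (h t) x i j).

End Coordinates.

Section Heisenberg.
Variables (R : realType) (n : nat).
Implicit Types (x y p v : 'rV[R]_(n + n + 1)).

(* With indices starting at 0, xi i, yi i and zi are the (1-based) indices
   i, i + n and N = 2n + 1. *)
Definition xi (i : 'I_n) : 'I_(n + n + 1) := lshift 1 (lshift n i).
Definition yi (i : 'I_n) : 'I_(n + n + 1) := lshift 1 (rshift n i).
Definition zi : 'I_(n + n + 1) := rshift (n + n) ord0.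

(* The global chart: the group element with coordinates x. *)
Definition heis_mx x : 'M[R]_(1 + (n + 1)) :=
  block_mx 1%:M (row_mx (lsubmx (lsubmx x)) (rsubmx x))
           0    (block_mx 1%:M (rsubmx (lsubmx x))^T
                          0    1%:M).

Definition heis_mul x y : 'rV[R]_(n + n + 1) :=
  x + y + row_mx 0 (lsubmx (lsubmx x) *m (rsubmx (lsubmx y))^T).

Lemma heis_mxM x y : heis_mx x *m heis_mx y = heis_mx (heis_mul x y).
Proof.
have E z : exists a b c, z = row_mx (row_mx a b) c :> 'rV[R]_(n + n + 1).
  exists (lsubmx (lsubmx z)), (rsubmx (lsubmx z)), (rsubmx z).
  by rewrite !hsubmxK.
have [a [b [c ->]]] := E x; have [a' [b' [c' ->]]] := E y.
rewrite /heis_mul /heis_mx !(row_mxKl, row_mxKr, add_row_mx, addr0).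
rewrite !mulmx_block mul_row_block.
rewrite !(mul1mx, mulmx1, mulmx0, mul0mx, addr0, add0r) add_row_mx.
rewrite linearD /= (addrC a') (addrC b'^T).
by rewrite [in RHS](addrC c) -addrA [c + _]addrC.
Qed.

(* theta x I is the row of components of theta^I at x in (dx^J)_J. *)
Definition theta x (I : 'I_(n + n + 1)) : 'rV[R]_(n + n + 1) :=
  delta_mx 0 I
  - (if I == zi then \sum_k x 0 (xi k) *: delta_mx 0 (yi k) else 0).

(* \sum_(I, J) G_IJ theta^I (x) theta^J *)
Definition left_metric (G : 'M[R]_(n + n + 1)) x : 'M[R]_(n + n + 1) :=
  \sum_I \sum_J G I J *: ((theta x I)^T *m theta x J).

Lemma theta_pairing x v I : (v *m (theta x I)^T) 0 0 =
  v 0 I - (if I == zi then \sum_k x 0 (xi k) * v 0 (yi k) else 0).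
Proof.
have pair_delta J : (v *m (delta_mx 0 J : 'rV_(n + n + 1))^T) 0 0 = v 0 J.
  rewrite trmx_delta mxE (bigD1 J)//= mxE !eqxx mulr1 big1 ?addr0// => j jJ.
  by rewrite mxE (negPf jJ) mulr0.
rewrite /theta linearB /= mulmxBr mxE pair_delta mxE; congr (_ - _).
case: ifP => _; last by rewrite trmx0 mulmx0 mxE.
rewrite linear_sum mulmx_sumr summxE; apply: eq_bigr => k _.
by rewrite linearZ /= -scalemxAr mxE pair_delta.
Qed.

(* Invariance of the coframe under left translations. *)
Lemma theta_left_invariant p x v I :
  ('D_v (heis_mul p) x *m (theta (heis_mul p x) I)^T) 0 0 =
  (v *m (theta x I)^T) 0 0.
Proof.
pose L : 'rV[R]_(n + n + 1) :=
  v + row_mx 0 (lsubmx (lsubmx p) *m (rsubmx (lsubmx v))^T).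
have DL : 'D_v (heis_mul p) x = L.
  apply/cvg_lim => //; apply: cvg_near_cst; near=> h.
  have h0 : h != 0 by near: h; exact: nbhs_dnbhs_neq.
  suff -> : (heis_mul p \o shift x) (h *: v) - heis_mul p x = h *: L.
    by rewrite scalerA mulVf// scale1r.
  rewrite /heis_mul /L /=; set a := lsubmx (lsubmx p).
  have -> : row_mx 0 (a *m (rsubmx (lsubmx (h *: v + x)))^T) =
    h *: row_mx 0 (a *m (rsubmx (lsubmx v))^T)
    + row_mx 0 (a *m (rsubmx (lsubmx x))^T) :> 'rV[R]_(n + n + 1).
    rewrite scale_row_mx add_row_mx scaler0 addr0 scalemxAr -mulmxDr.
    by rewrite !linearD !linearZ.
  rewrite scalerDr; set r := h *: row_mx _ _; set q := row_mx _ _.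
  by rewrite [p + (_ + _)]addrCA addrACA addrK.
have Lx k : heis_mul p x 0 (xi k) = p 0 (xi k) + x 0 (xi k).
  by rewrite /heis_mul mxE row_mxEl !mxE addr0.
have Ly k : L 0 (yi k) = v 0 (yi k) by rewrite /L mxE row_mxEl mxE addr0.
rewrite DL !theta_pairing; under eq_bigr do rewrite Lx Ly mulrDl.
case: ifP => [/eqP ->|Iz]; last first.
  rewrite /L mxE; case/boolP: (I < n + n)%N => [In|].
    have -> : I = lshift 1 (Ordinal In) by exact: val_inj.
    by rewrite row_mxEl mxE addr0.
  rewrite -leqNgt => nI; move: Iz; rewrite -val_eqE /= addn0 eqn_leq nI andbT.
  by rewrite -ltnS -[(n + n).+1]addn1 ltn_ord.
rewrite big_split /= /L mxE row_mxEr opprD addrA; congr (_ - _).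
rewrite -[RHS]addr0 -addrA; congr (_ + _).
apply/eqP; rewrite subr_eq0; apply/eqP; rewrite mxE; apply: eq_bigr => k _.
by rewrite !mxE.
Unshelve. all: by end_near.
Qed.

(* Ricci flow on [0, +oo[ through diagonal left-invariant metrics. *)
Definition diagonal_solution (G0 : 'M[R]_(n + n + 1))
    (G : R -> 'M[R]_(n + n + 1)) : Prop :=
  [/\ G 0 = G0,
      forall t, 0 <= t -> is_metric_mx (G t) /\ is_diag_mx (G t)
    & ricci_flow (fun t => left_metric (G t))].

End Heisenberg.

Arguments zi {n}.

Definition asymp (R : realType) (f g : R -> R) : Prop :=
  f t / g t @[t --> +oo] --> (1 : R).

(* Main.v *)
Require Import Defs.
From HB Require Import structures.
From mathcomp Require Import all_boot all_order all_algebra.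
From mathcomp Require Import all_classical all_reals all_analysis.
From mathcomp Require Import ring lra.
Set Implicit Arguments.
Unset Strict Implicit.
Unset Printing Implicit Defensive.
Import Order.TTheory GRing.Theory Num.Theory.
Import numFieldNormedType.Exports.
Local Open Scope classical_set_scope.
Local Open Scope ring_scope.

(** In the coframe theta, write a_k, b_k and c for the coefficients g_k, g_(k+n)
and g_N of a diagonal metric. Its Ricci tensor is diagonal with entries
- c / (2 b_k), - c / (2 a_k) and (c^2 / 2) sum_k 1 / (a_k b_k)
([ricci_heis_diag]), so that the flow is the system
a_k' = c / b_k,  b_k' = c / a_k,  c' = - c^2 sum_k 1 / (a_k b_k)
([ricci_flow_ode]).

This system has many first integrals. The ratios a_k / b_k are constant
([heis_ratio_constant]); the products p_k = a_k b_k all have derivative 2 c, so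
p_k = p_k(0) + s with s' = 2 c; and c^2 prod_k p_k is constant, equal to C
([heis_first_integral]). Hence s satisfies the scalar equation
s' = 2 sqrt C / sqrt (prod_k (p_k(0) + s)). Solving it by separation of
variables gives existence for all times ([heis_ode_solution]). Comparing the
product with (s + M)^n, where M is an upper or a lower bound of the p_k(0), shows
that (s + M)^((n+2)/2) lies above or below a function of the form
(n + 2) sqrt C t + constant, so that every p_k is equivalent to
((n + 2) sqrt C t)^(2/(n+2)). The equivalents of a_k, b_k and c follow
since a_k^2 = (a_k / b_k) p_k and c^2 = C / prod_k p_k
([heis_asymp_a], [heis_asymp_b], [heis_asymp_c]).

The Ricci tensor is computed at all points, for a metric
D + c zeta^T zeta with zeta an affine function of the point, as it comes from any
two-step nilpotent group with one-dimensional centre: the Christoffel symbols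
are then expressed by constant matrices and zeta, and
Rc = (c/2) w Di w - (c^2/4) tr ((w Di)^2) zeta^T zeta, where w is the
skew form of the group and Di the inverse of D on the horizontal directions
([ricci_two_step]). *)

(** All components differentiated below are polynomials of degree at most two
along a coordinate line, so that a partial derivative is read off from an
expansion and no differentiability has to be carried around. *)
Lemma partial_quadratic (R : realType) (d : nat) (k : 'I_d)
    (f : 'rV[R]_d -> R) x (e1 e2 : R) :
  (forall t, f (t *: delta_mx 0 k + x) = f x + (t * e1 + t ^+ 2 * e2)) ->
  partial k f x = e1.
Proof.
move=> fE; apply/cvg_lim => //.
have c1 : e1 + t * e2 @[t --> (0 : R)^'] --> e1.
  rewrite -[X in _ --> X]addr0 -[X in _ + X](mul0r e2).
  apply: cvgD; first exact: cvg_cst.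
  by apply: cvgMl; exact: cvg_within_filter cvg_id.
apply: cvg_trans c1; apply: near_eq_cvg; near=> t.
have t0 : t != 0 by near: t; exact: nbhs_dnbhs_neq.
rewrite /= fE addrAC subrr add0r /GRing.scale /= expr2 -mulrA -mulrDr.
by rewrite mulKf.
Unshelve. all: by end_near.
Qed.

(** * Ricci tensor of a two-step nilpotent group with one-dimensional centre *)

(** The bilinear form beta(u, v) = u B v^T is the cocycle of the group law, Z
spans the centre, zeta x = Z - x B is the central left-invariant form at x,
and D is the metric on the horizontal directions, with inverse Di there.
The skew form w = B - B^T is, up to sign, the differential of zeta. *)
Section TwoStepRicci.
Variables (R : realType) (d : nat) (B D Di : 'M[R]_d) (Z : 'rV[R]_d) (c : R).
Hypotheses (ZB : Z *m B = 0) (BZ : B *m Z^T = 0) (ZZ : Z *m Z^T = 1%:M).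
Hypotheses (DT : D^T = D) (DiT : Di^T = Di) (ZD : Z *m D = 0).
Hypotheses (ZDi : Z *m Di = 0) (DDi : D *m Di = 1%:M - Z^T *m Z).
Hypothesis (c0 : c != 0).
Implicit Types (x : 'rV[R]_d) (i j k l : 'I_d).

Let zeta x : 'rV[R]_d := Z - x *m B.
Let h x : 'M[R]_d := D + c *: ((zeta x)^T *m zeta x).
Let w : 'M[R]_d := B - B^T.
Let S : 'M[R]_d := B + B^T.
(* J x is w with its second index raised by h x (see J_h), and K is its
   horizontal part, which does not depend on x. They are variables specified
   by equations because unification would otherwise unfold the products. *)
Variables (K : 'M[R]_d) (J : 'rV[R]_d -> 'M[R]_d).
Hypotheses (KE : K = w *m Di) (JE : forall x, J x = K + K *m (x *m B)^T *m Z).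

Let ZBT : Z *m B^T = 0.
Proof. by rewrite -[Z]trmxK -trmx_mul BZ trmx0. Qed.

Let BTZ : B^T *m Z^T = 0.
Proof. by rewrite -trmx_mul ZB trmx0. Qed.

Let DiZ : Di *m Z^T = 0.
Proof. by rewrite -DiT -trmx_mul ZDi trmx0. Qed.

Let DiD : Di *m D = 1%:M - Z^T *m Z.
Proof.
rewrite -[LHS]trmxK trmx_mul DT DiT DDi linearB /= trmx1 trmx_mul trmxK.
by [].
Qed.

Let ZK : Z *m K = 0.
Proof. by rewrite KE /w mulmxA mulmxBr ZB ZBT subrr mul0mx. Qed.

Let ZS : Z *m S = 0.
Proof. by rewrite /S mulmxDr ZB ZBT addr0. Qed.

Let wT : w^T = - w.
Proof. by rewrite /w linearB /= trmxK opprB. Qed.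

Let wZ : w *m Z^T = 0.
Proof. by rewrite /w mulmxBl BZ BTZ subrr. Qed.

Let ZzetaT x : Z *m (zeta x)^T = 1%:M.
Proof.
by rewrite /zeta linearB /= trmx_mul mulmxBr ZZ mulmxA ZBT mul0mx subr0.
Qed.

Let ZJ x : Z *m J x = 0.
Proof. by rewrite JE mulmxDr !mulmxA ZK !mul0mx addr0. Qed.

Let KZ : K *m Z^T = 0.
Proof. by rewrite KE -mulmxA DiZ mulmx0. Qed.

Let J_zeta x : J x *m (zeta x)^T = 0.
Proof.
rewrite JE mulmxDl -(mulmxA _ Z) ZzetaT mulmx1 /zeta linearB /= mulmxBr.
by rewrite KZ sub0r addNr.
Qed.

Let J_B x : J x *m B = K *m B.
Proof. by rewrite JE mulmxDl -(mulmxA _ Z) ZB mulmx0 addr0. Qed.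

Let J_BT x : J x *m B^T = K *m B^T.
Proof. by rewrite JE mulmxDl -(mulmxA _ Z) ZBT mulmx0 addr0. Qed.

Let J_S x : J x *m S = K *m S.
Proof. by rewrite /S !mulmxDr J_B J_BT. Qed.

Let J_h x : J x *m h x = w.
Proof.
rewrite /h mulmxDr -scalemxAr mulmxA J_zeta mul0mx scaler0 addr0.
rewrite JE mulmxDl -(mulmxA _ Z) ZD mulmx0 addr0 KE -mulmxA DiD mulmxBr.
by rewrite mulmx1 mulmxA wZ mul0mx subr0.
Qed.

Let Z_h x : Z *m h x = c *: zeta x.
Proof. by rewrite /h mulmxDr ZD add0r -scalemxAr mulmxA ZzetaT mul1mx. Qed.

Let hT x : (h x)^T = h x.
Proof. by rewrite /h linearD /= DT linearZ /= trmx_mul trmxK. Qed.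

Let h_Z x : h x *m Z^T = c *: (zeta x)^T.
Proof. by rewrite -[LHS]trmxK trmx_mul trmxK hT Z_h linearZ. Qed.

(** With p = x B, the explicit inverse of h x is
(1 + Z^T p) Di (1 + p^T Z) + c^-1 Z^T Z. *)
Let h_unit x : h x \in unitmx.
Proof.
set p := x *m B; have pZ : p *m Z^T = 0 by rewrite /p -mulmxA BZ mulmx0.
have Zp : Z *m p^T = 0 by rewrite -[Z]trmxK -trmx_mul pZ trmx0.
have zetaE : zeta x = Z - p by [].
have hP : h x *m (1%:M + Z^T *m p) = D + c *: ((zeta x)^T *m Z).
  rewrite mulmxDr mulmx1 mulmxA h_Z -scalemxAl /h -addrA -scalerDr -mulmxDr.
  by rewrite {2}zetaE subrK.
apply: (proj1 (mulmx1_unit (B := (1%:M + Z^T *m p) *m (Di *m (1%:M + p^T *m Z))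
  + c^-1 *: (Z^T *m Z)) _)).
rewrite [LHS]mulmxDr (mulmxA (h x)) hP -scalemxAr (mulmxA _ Z^T) h_Z.
rewrite -scalemxAl scalerA mulVf// scale1r (mulmxA _ Di) mulmxDl DDi.
rewrite -scalemxAl -mulmxA ZDi mulmx0 scaler0 addr0 mulmxDr mulmx1 mulmxBl mul1mx.
rewrite -(mulmxA Z^T) (mulmxA Z p^T) Zp mul0mx mulmx0 subr0 zetaE linearB /=.
by rewrite mulmxBl addrACA subrr addr0 subrK.
Qed.

Let d_zeta x i t : zeta (t *: delta_mx 0 i + x) = zeta x - t *: row i B.
Proof. by rewrite /zeta mulmxDl -scalemxAl -rowE opprD addrA addrAC. Qed.

Let partial_h x i j l :
  partial i (fun y => h y j l) x =
  - c * (B i j * zeta x 0 l + zeta x 0 j * B i l).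
Proof.
apply: (partial_quadratic (e2 := c * (B i j * B i l))) => t.
have hE y : h y j l = D j l + c * (zeta y 0 j * zeta y 0 l).
  by rewrite !mxE big_ord1 !mxE.
by rewrite !hE d_zeta !(mxE, big_ord1); ring.
Qed.

(** The row of Christoffel symbols Gamma^k_ij: the symmetric part of beta along
the centre, and a horizontal part built from J. Lowering the index with h gives
the usual combination of first derivatives of the metric. *)
Let gamma x i j : 'rV[R]_d :=
  - (2^-1 * S i j) *: Z
  - (c / 2) *: (zeta x 0 j *: row i (J x) + zeta x 0 i *: row j (J x)).

Let gamma_h x i j l : (gamma x i j *m h x) 0 l =
  - (c / 2) * (S i j * zeta x 0 l + zeta x 0 j * w i l + zeta x 0 i * w j l).
Proof.
rewrite /gamma mulmxBl -!scalemxAl mulmxDl -!scalemxAl Z_h -!row_mul J_h.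
by move: (zeta x) => z; rewrite !mxE; field.
Qed.

Let christoffelE x k i j : christoffel h k i j x = gamma x i j 0 k.
Proof.
rewrite /christoffel -[gamma x i j]mulmx1 -(mulmxV (h_unit x)) mulmxA.
rewrite [RHS]mxE mulr_sumr; apply: eq_bigr => l _.
rewrite -[in invmx _ l k](hT x) -trmx_inv [_^T l k]mxE gamma_h !partial_h.
by rewrite /S /w !mxE; field.
Qed.

Let d_J x m t : J (t *: delta_mx 0 m + x) =
  J x + t *: (K *m (row m B)^T *m Z).
Proof.
rewrite !JE mulmxDl -scalemxAl -rowE linearD linearZ /= mulmxDr mulmxDl.
by rewrite -scalemxAr -scalemxAl addrA addrAC.
Qed.

Let KBE m i k : (K *m (row m B)^T *m Z) i k = (K *m B^T) i m * Z 0 k.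
Proof.
rewrite mxE big_ord1; congr (_ * _); rewrite !mxE.
by apply: eq_bigr => a _; rewrite !mxE.
Qed.

Let partial_gamma x m k i j :
  partial m (christoffel h k i j) x =
  c / 2 * (B m j * J x i k + B m i * J x j k
           - zeta x 0 j * (K *m B^T) i m * Z 0 k
           - zeta x 0 i * (K *m B^T) j m * Z 0 k).
Proof.
apply: (partial_quadratic (e2 := c / 2 * (B m j * ((K *m B^T) i m * Z 0 k)
   + B m i * ((K *m B^T) j m * Z 0 k)))) => t.
rewrite !christoffelE /gamma d_zeta d_J.
set q := _ *m Z; move: (KBE m^~ k); rewrite -/q.
move: q (K *m B^T) (zeta x) (J x) => q q' z j' qE.
by rewrite !mxE !qE; field.
Qed.

Let entry_sum (M N : 'M[R]_d) i j : \sum_k M i k * N k j = (M *m N) i j.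
Proof. by rewrite mxE. Qed.

Let trK : \tr K = 0.
Proof.
apply/eqP; rewrite -[_ == 0](mulrn_eq0 _ 2) mulr2n addr_eq0; apply/eqP.
by rewrite {1}KE -mxtrace_tr trmx_mul DiT wT mulmxN linearN /= mxtrace_mulC KE.
Qed.

Let trJ x : \tr (J x) = 0.
Proof.
rewrite JE mxtraceD trK add0r mxtrace_mulC mulmxA ZK mul0mx.
by rewrite linear0.
Qed.

Let trJJ x : \tr (J x *m J x) = \tr (K *m K).
Proof.
rewrite {2}JE mulmxDr mxtraceD (mxtrace_mulC (J x) (_ *m Z)) -!mulmxA ZJ.
rewrite !mulmx0 linear0 addr0 JE mulmxDl -(mulmxA _ Z) ZK mulmx0.
by rewrite addr0.
Qed.

Let row_sum (u : 'rV[R]_d) (M : 'M[R]_d) j :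
  \sum_k u 0 k * M k j = (u *m M) 0 j.
Proof. by rewrite mxE. Qed.

Let row_pair m (M : 'M[R]_(m, d)) (u : 'rV[R]_d) (i : 'I_m) :
  \sum_k M i k * u 0 k = (M *m u^T) i 0.
Proof. by rewrite mxE; apply: eq_bigr => k _; rewrite mxE. Qed.

(** The second sum vanishes: it collects the derivatives of the traces of the
connection, and tr J = 0 because K is the product of a skew and a symmetric
matrix. *)
Let ricci_divergence x i j :
  \sum_k (partial k (christoffel h k i j) x
          - partial j (christoffel h k i k) x) =
  c / 2 * ((K *m B) i j + (K *m B) j i).
Proof.
rewrite sumrB.
transitivity (c / 2 * ((J x *m B) i j + (J x *m B) j i
      - zeta x 0 j * (K *m B^T *m Z^T) i 0
      - zeta x 0 i * (K *m B^T *m Z^T) j 0)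
    - c / 2 * ((J x *m B^T) i j + B j i * \tr (J x)
      - (K *m B^T) i j * (Z *m (zeta x)^T) 0 0
      - zeta x 0 i * (Z *m (K *m B^T)) 0 j)); last first.
  rewrite J_B J_BT trJ ZzetaT -!(mulmxA K) BTZ (mulmxA Z) ZK mul0mx.
  have zero_mxE p q (a : 'I_p) (b : 'I_q) : (0 : 'M[R]_(p, q)) a b = 0.
    by rewrite mxE.
  by rewrite mulmx0 !zero_mxE [1%:M 0 0]mxE eqxx mulr1n; ring.
congr (_ - _).
  rewrite -!(row_pair (K *m B^T) Z) -!(entry_sum (J x) B) !mulr_sumr -!big_split.
  rewrite /= -!sumrB mulr_sumr.
  by apply: eq_bigr => k _; rewrite partial_gamma; ring.
rewrite -(row_sum Z (K *m B^T)) -(row_pair Z (zeta x)) -(entry_sum (J x) B^T).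
rewrite !mulr_sumr -!big_split /= -!sumrB mulr_sumr.
by apply: eq_bigr => k _; rewrite partial_gamma [B^T k j]mxE; ring.
Qed.

Let trace_gamma x k : \sum_l gamma x l k 0 l = 0.
Proof.
rewrite (_ : \sum_l _ = - 2^-1 * (Z *m S) 0 k
  - c / 2 * (zeta x 0 k * \tr (J x) + (J x *m (zeta x)^T) k 0)).
  by rewrite ZS trJ J_zeta !mxE; ring.
rewrite -(row_sum Z S) -(row_pair (J x) (zeta x)) !mulr_sumr -big_split.
rewrite /= mulr_sumr -sumrB; apply: eq_bigr => l _.
by rewrite /gamma; move: (zeta x) S => z s; rewrite !mxE; field.
Qed.

(* The endomorphism v |-> Gamma(e_i, v), acting on rows from the right. *)
Let Gam x i : 'M[R]_d :=
  - (2^-1 *: ((row i S)^T *m Z)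
     + (c / 2) *: ((zeta x)^T *m row i (J x) + zeta x 0 i *: J x)).

Let GamE x i l k : Gam x i l k = gamma x i l 0 k.
Proof.
have sE : S i l = (row i S)^T l 0 by rewrite !mxE.
rewrite /Gam /gamma sE; move: (row i S)^T => s; move: (zeta x) => z.
by rewrite !(mxE, big_ord1); ring.
Qed.

(** Expand the product of the two sums of three terms: apart from the two
rank-one terms pairing S with J and the term tr (J J), each product contains, up
to a cyclic permutation under the trace, a factor Z J, J zeta^T or Z S, which is
zero. *)
Let trace_Gam x i j : \tr (Gam x j *m Gam x i) =
  c / 4 * ((K *m S) i j + (K *m S) j i)
  + c ^+ 2 / 4 * (zeta x 0 i * zeta x 0 j) * \tr (K *m K).
Proof.
have tr_rank1 (u v : 'rV[R]_d) : \tr (u^T *m v) = (v *m u^T) 0 0.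
  by rewrite mxtrace_mulC /mxtrace big_ord1.
have r_zeta a : row a (J x) *m (zeta x)^T = 0.
  by rewrite -row_mul J_zeta row0.
have Z_S a : Z *m (row a S)^T = 0.
  have ST : S^T = S by rewrite /S linearD /= trmxK addrC.
  by rewrite tr_row ST colE mulmxA ZS mul0mx.
have r_S a b : (row a (J x) *m (row b S)^T) 0 0 = (K *m S) a b.
  rewrite -(J_S x).
  rewrite [LHS]mxE [RHS]mxE; apply: eq_bigr => k _.
  rewrite [_^T _ _]mxE ![row _ _ _ _]mxE; congr (_ * _).
  by rewrite !mxE addrC.
pose X a := (row a S)^T *m Z; pose Y a := (zeta x)^T *m row a (J x).
have XX : X j *m X i = 0 by rewrite /X mulmxA -(mulmxA _ Z) Z_S mulmx0 mul0mx.
have XYE a : X a *m (zeta x)^T = (row a S)^T by rewrite -mulmxA ZzetaT mulmx1.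
have XY : \tr (X j *m Y i) = (K *m S) i j.
  by rewrite /Y mulmxA XYE tr_rank1 r_S.
have YX : \tr (Y j *m X i) = (K *m S) j i.
  by rewrite mxtrace_mulC /Y mulmxA XYE tr_rank1 r_S.
have XJ a : X a *m J x = 0 by rewrite -mulmxA ZJ mulmx0.
have YY : Y j *m Y i = 0 by rewrite /Y mulmxA -(mulmxA _ _ (zeta x)^T) r_zeta
  mulmx0 mul0mx.
have JY a : J x *m Y a = 0 by rewrite mulmxA J_zeta mul0mx.
have GE a : Gam x a = - (2^-1 *: X a + (c / 2) *: (Y a + zeta x 0 a *: J x)).
  by [].
move: (K *m S) XY YX => KS XY YX.
rewrite !GE mulNmx mulmxN opprK mulmxDl !mulmxDr -!scalemxAl -!scalemxAr.
rewrite !(mulmxDl, mulmxDr) -!scalemxAl -!scalemxAr XX XJ YY JY.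
rewrite !(scaler0, addr0, add0r) !(mxtraceD, mxtraceZ) XY YX.
rewrite (mxtrace_mulC (J x) (X i)) XJ (mxtrace_mulC (Y j)) JY.
rewrite linear0 trJJ.
by field.
Qed.

Let ricci_quadratic x i j :
  \sum_k \sum_l (christoffel h k k l x * christoffel h l i j x
                    - christoffel h k j l x * christoffel h l i k x) =
  - \tr (Gam x j *m Gam x i).
Proof.
under eq_bigr do rewrite sumrB; rewrite sumrB exchange_big /=.
rewrite big1 ?sub0r; last first.
  move=> l _; rewrite -mulr_suml.
  under eq_bigr do rewrite christoffelE.
  by rewrite trace_gamma mul0r.
congr (- _); rewrite exchange_big /mxtrace /=; apply: eq_bigr => l _.
rewrite mxE; apply: eq_bigr => k _.
by rewrite !christoffelE !GamE.
Qed.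

(** Since w is skew, for a Riemannian metric the horizontal part is nonpositive
and the coefficient of the central part is nonnegative. *)
Lemma ricci_two_step x : ricci h x =
  (c / 2) *: (w *m Di *m w)
  - (c ^+ 2 / 4 * \tr (w *m Di *m (w *m Di))) *: ((zeta x)^T *m zeta x).
Proof.
apply/matrixP => i j.
rewrite [LHS]mxE [RHS]mxE [(_ *: (_ *m w)) i j]mxE.
rewrite ricci_divergence ricci_quadratic trace_Gam -KE.
have KwT : (K *m w)^T = K *m w.
  by rewrite KE !trmx_mul DiT wT !(mulNmx, mulmxN) opprK mulmxA.
have -> : (K *m w) i j = 2^-1 * ((K *m w) i j + (K *m w) j i).
  by rewrite -[in X in _ + X]KwT [_^T j i]mxE; field.
rewrite /S /w mulmxDr mulmxBr; move: (K *m B) (K *m B^T) (zeta x) => p q z.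
by rewrite !(mxE, big_ord1); field.
Qed.

End TwoStepRicci.

(** * Diagonal left-invariant metrics on the Heisenberg group *)

Section HeisenbergRicci.
Variables (R : realType) (n : nat).
Implicit Types (a b : 'rV[R]_n) (c : R) (x : 'rV[R]_(n + n + 1)).

Definition heis_diag a b c : 'M[R]_(n + n + 1) :=
  diag_mx (row_mx (row_mx a b) c%:M).

Let Z : 'rV[R]_(n + n + 1) := row_mx 0 1%:M.
Let B : 'M[R]_(n + n + 1) := block_mx (block_mx 0 1%:M 0 0) 0 0 0.

Lemma big_heis (V : nmodType) (F : 'I_(n + n + 1) -> V) :
  \sum_I F I = \sum_k F (xi k) + \sum_k F (yi k) + F zi.
Proof. by rewrite !big_split_ord /= big_ord1. Qed.

Lemma xi_neq_zi (k : 'I_n) : (xi k == zi) = false.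
Proof. by rewrite eq_lrshift. Qed.

Lemma yi_neq_zi (k : 'I_n) : (yi k == zi) = false.
Proof. by rewrite eq_lrshift. Qed.

Lemma heis_diag_xi a b c k : heis_diag a b c (xi k) (xi k) = a 0 k.
Proof. by rewrite mxE eqxx mulr1n !row_mxEl. Qed.

Lemma heis_diag_yi a b c k : heis_diag a b c (yi k) (yi k) = b 0 k.
Proof. by rewrite mxE eqxx mulr1n row_mxEl row_mxEr. Qed.

Lemma heis_diag_zi a b c : heis_diag a b c zi zi = c.
Proof. by rewrite mxE eqxx mulr1n row_mxEr mxE eqxx. Qed.

Definition heis_diagE := (heis_diag_xi, heis_diag_yi, heis_diag_zi).

Lemma heis_ind (P : 'I_(n + n + 1) -> Prop) :
  (forall k, P (xi k)) -> (forall k, P (yi k)) -> P zi -> forall i, P i.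
Proof.
move=> Px Py Pz i; case: (split_ordP i) => j ->; last by rewrite ord1.
by case: (split_ordP j) => k ->; [exact: Px|exact: Py].
Qed.

Lemma is_diag_heis_diag (G : 'M[R]_(n + n + 1)) : is_diag_mx G ->
  G = heis_diag (\row_k G (xi k) (xi k)) (\row_k G (yi k) (yi k)) (G zi zi).
Proof.
move=> /is_diag_mxP Gd; apply/matrixP => i j.
have [<-{j}|/eqP ij] := eqVneq i j; last first.
  rewrite mxE; move/eqP/negPf: (ij) => ->.
  by rewrite mulr0n; apply: Gd; apply: contra_notN ij => /eqP/val_inj.
by elim/heis_ind: i => [k|k|]; rewrite heis_diagE// mxE.
Qed.

(** Only the last coframe element depends on the point, so the metric has the
form D + c zeta^T zeta treated above. *)
Lemma left_metric_heis_diag a b c x : left_metric (heis_diag a b c) x =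
  heis_diag a b 0 + c *: ((Z - x *m B)^T *m (Z - x *m B)).
Proof.
have ZE : Z = delta_mx 0 zi.
  apply/rowP; apply: heis_ind => [k|k|]; rewrite ?row_mxEl ?row_mxEr !mxE;
    by rewrite ?xi_neq_zi ?yi_neq_zi !eqxx.
have xB : x *m B = \sum_k x 0 (xi k) *: delta_mx 0 (yi k).
  rewrite -[x in x *m _](hsubmxK x) -[lsubmx x](hsubmxK (lsubmx x)).
  rewrite /B mul_row_block mul_row_block.
  rewrite !(mulmx0, mul0mx, mulmx1, addr0, add0r).
  apply/rowP; apply: heis_ind => [l|l|]; rewrite summxE.
  - rewrite !row_mxEl mxE big1// => k _.
    by rewrite !mxE /xi /yi eq_lshift eq_lrshift andbF mulr0.
  - rewrite row_mxEl row_mxEr !mxE (bigD1 l)//= !mxE !eqxx mulr1 big1 ?addr0//.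
    move=> k kl; rewrite !mxE /yi eq_lshift eq_rshift.
    by rewrite eq_sym (negPf kl) mulr0.
  - rewrite row_mxEr mxE big1// => k _.
    by rewrite !mxE [zi == _]eq_sym yi_neq_zi andbF mulr0.
have -> : left_metric (heis_diag a b c) x =
    \sum_I heis_diag a b c I I *: ((theta x I)^T *m theta x I).
  apply: eq_bigr => I _; rewrite (bigD1 I)//= big1 ?addr0// => J JI.
  by rewrite mxE eq_sym (negPf JI) mulr0n scale0r.
rewrite big_heis heis_diag_zi; congr (_ + _); last first.
  by rewrite /theta eqxx -ZE -xB.
rewrite [RHS]diag_mx_sum_delta big_heis.
rewrite [X in _ + _ + X](_ : _ = 0) ?addr0; last first.
  by rewrite row_mxEr mxE mul0rn scale0r.
congr (_ + _); apply: eq_bigr => k _; rewrite /theta.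
  by rewrite heis_diag_xi xi_neq_zi subr0 trmx_delta mul_delta_mx !row_mxEl.
rewrite heis_diag_yi yi_neq_zi subr0 trmx_delta mul_delta_mx.
by rewrite row_mxEl row_mxEr.
Qed.

(** Block multiplication evaluates c w Di w / 2 and tr ((w Di)^2): a diagonal
metric has a diagonal Ricci tensor in the same coframe. *)
Lemma ricci_heis_diag a b c x :
  (forall k, a 0 k != 0) -> (forall k, b 0 k != 0) -> c != 0 ->
  ricci (left_metric (heis_diag a b c)) x =
  left_metric (heis_diag (\row_k (- (c / 2) / b 0 k))
    (\row_k (- (c / 2) / a 0 k))
    (c ^+ 2 / 2 * \sum_k (a 0 k * b 0 k)^-1)) x.
Proof.
move=> a0 b0 c0.
pose ai : 'rV[R]_n := \row_k (a 0 k)^-1.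
pose bi : 'rV[R]_n := \row_k (b 0 k)^-1.
have diagE u v e : heis_diag u v e =
    block_mx (block_mx (diag_mx u) 0 0 (diag_mx v)) 0 0 e%:M.
  rewrite /heis_diag !diag_mx_row; congr block_mx.
  by apply/matrixP => i j; rewrite !mxE !ord1 eqxx.
have aiE : diag_mx a *m diag_mx ai = 1%:M.
  rewrite mulmx_diag -diag_const_mx; congr diag_mx; apply/rowP => k.
  by rewrite !mxE mulfV.
have biE : diag_mx b *m diag_mx bi = 1%:M.
  rewrite mulmx_diag -diag_const_mx; congr diag_mx; apply/rowP => k.
  by rewrite !mxE mulfV.
have simp := (mul0mx, mulmx0, mul1mx, mulmx1, addr0, add0r, block_mx0, scaler0,
  raddf0).
have BTE : B^T = block_mx (block_mx 0 0 1%:M 0) 0 0 0.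
  by rewrite /B !tr_block_mx !trmx0 trmx1.
have ZTE : Z^T = col_mx 0 1%:M by rewrite tr_row_mx trmx0 trmx1.
have lmE : left_metric (heis_diag a b c) =
    fun x => heis_diag a b 0 + c *: ((Z - x *m B)^T *m (Z - x *m B)).
  by apply/funext => y; exact: left_metric_heis_diag.
have ZB : Z *m B = 0 by rewrite /Z mul_row_block !simp row_mx0.
have BZ : B *m Z^T = 0 by rewrite ZTE mul_block_col !simp col_mx0.
have ZZ : Z *m Z^T = 1%:M by rewrite ZTE mul_row_col !simp.
have ZD u v : Z *m heis_diag u v 0 = 0.
  by rewrite diagE /Z mul_row_block !simp row_mx0.
have DDi : heis_diag a b 0 *m heis_diag ai bi 0 = 1%:M - Z^T *m Z.
  rewrite !diagE !mulmx_block !simp aiE biE -scalar_mx_block ZTE mul_col_row.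
  rewrite !simp (scalar_mx_block _ 1 1) opp_block_mx add_block_mx.
  by rewrite (subrr 1%:M) !subr0.
rewrite lmE (ricci_two_step ZB BZ ZZ (tr_diag_mx _) (tr_diag_mx _) (ZD _ _)
  (ZD _ _) DDi c0 erefl (fun=> erefl)).
have wE : (B - B^T) *m heis_diag ai bi 0 =
  block_mx (block_mx 0 (diag_mx bi) (- diag_mx ai) 0) 0 0 0.
  rewrite BTE /B opp_block_mx !add_block_mx !opp_block_mx !add_block_mx.
  rewrite diagE !mulmx_block !simp.
  by rewrite mulNmx mul1mx.
rewrite wE.
rewrite (_ : _ *m (B - B^T) =
  block_mx (block_mx (- diag_mx bi) 0 0 (- diag_mx ai)) 0 0 0); last first.
  rewrite BTE /B opp_block_mx !add_block_mx !opp_block_mx !add_block_mx.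
  rewrite !mulmx_block !simp.
  by rewrite mulmxN mulmx1.
rewrite mulmx_block !simp mulmx_block !simp mulmxN mulNmx diag_mxC.
rewrite !mxtrace_block mxtrace0 addr0 !linearN /= mulmx_diag mxtrace_diag.
rewrite left_metric_heis_diag -scaleNr; congr (_ + _ *: _).
  rewrite diagE scale_block_mx !simp scale_block_mx !simp.
  rewrite -!linearN -!linearZ /=.
  congr block_mx; congr block_mx; congr diag_mx; apply/rowP => i.
    by rewrite !mxE; ring.
  by rewrite !mxE; ring.
rewrite -opprD -mulr2n (eq_bigr (fun k => (a 0 k * b 0 k)^-1)); last first.
  by move=> k _; rewrite !mxE invfM.
by rewrite -mulr_natl; field.
Qed.

End HeisenbergRicci.

(** * One-sided derivatives on the half-line *)

Lemma is_derive_quotient (R : realType) (f : R -> R) (t l : R) :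
  is_derive t 1 f l <-> (fun s => (f s - f t) / (s - t)) @ t^' --> l.
Proof.
have shift_dnbhs (Q : R -> Prop) :
    (\forall s \near t^', Q s) <-> (\forall h \near 0^', Q (h + t)).
  have E : (\forall s \near t, s != t -> Q s) <->
      (\forall h \near 0, h + t != t -> Q (h + t)).
    by rewrite (near_shift 0 t) subr0.
  rewrite !near_withinE; split=> H; last apply/E; [have/E := H|move: H];
    apply: filterS => h /= + h0; apply.
    by rewrite -subr_eq0 addrK.
  by move: h0; rewrite -subr_eq0 addrK.
pose q s := (f s - f t) / (s - t).
have qE : (fun h => h^-1 *: ((f \o shift t) (h *: 1) - f t)) =
    (fun h => q (h + t)).
  by apply/funext => h; rewrite /q /= [h *: _]mulr1 addrK [LHS]mulrC.
have cvgE : (fun h => h^-1 *: ((f \o shift t) (h *: 1) - f t)) @ 0^' --> l <->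
    q @ t^' --> l.
  by rewrite qE; split=> H P Pl; apply/(shift_dnbhs (P \o q)); exact: H.
split=> [[fl dl]|/cvgE H]; first by apply/cvgE; rewrite -dl; exact: fl.
by split; [apply/cvg_ex; exists l|exact/cvg_lim].
Qed.

Lemma is_derive_has_deriv_ge0 (R : realType) (f : R -> R) (t l : R) :
  is_derive t 1 f l -> has_deriv_ge0 f t l.
Proof. by move=> /is_derive_quotient; exact: cvg_within_filter. Qed.

Lemma eq_has_deriv_ge0 (R : realType) (f g : R -> R) (t l : R) :
  (forall s : R, 0 <= s -> f s = g s) -> 0 <= t ->
  has_deriv_ge0 f t l -> has_deriv_ge0 g t l.
Proof.
move=> fg t0; apply: cvg_trans; apply: near_eq_cvg.
by apply: filterS (withinT _ _) => s s0; rewrite !fg.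
Qed.

(** Continuing f to the left of 0 by its tangent line makes the derivative
two-sided at 0, so that the differential calculus of the library applies at
every t >= 0. *)
Lemma has_deriv_ge0_extension (R : realType) (f l : R -> R) :
  (forall t : R, 0 <= t -> has_deriv_ge0 f t (l t)) ->
  exists2 F : R -> R, forall t : R, 0 <= t -> F t = f t
    & forall t : R, 0 <= t -> is_derive t 1 F (l t).
Proof.
move=> H; pose F s := if 0 <= s then f s else f 0 + l 0 * s.
have FE t : 0 <= t -> F t = f t by rewrite /F => ->.
exists F => // t t0; apply/is_derive_quotient => P Pl.
have HP : \forall s \near t^', 0 <= s -> P ((f s - f t) / (s - t)).
  exact: H t t0 P Pl.
have : \forall s \near t^', 0 <= s \/ t = 0.
  move: t0; rewrite le_eqVlt => /predU1P[<-|t0]; first by apply: nearW; right.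
  apply: nbhs_dnbhs; near=> s; left; near: s.
  exact: lt_le_nbhsr.
move: HP; apply: filterS2 => s HP st; rewrite /= (FE _ t0).
have [s0|s0] := leP 0 s; first by rewrite FE //; exact: HP.
case: st => [|t00]; first by rewrite leNgt s0.
rewrite /F leNgt s0 /= t00 addrAC subrr add0r subr0 mulfK ?lt_eqF//.
by rewrite -t00; exact: nbhs_singleton.
Unshelve. all: by end_near.
Qed.

Lemma nondecreasing_ge0 (R : realType) (f l : R -> R) :
  (forall t : R, 0 <= t -> is_derive t 1 f (l t)) ->
  (forall t : R, 0 <= t -> 0 <= l t) ->
  forall t : R, 0 <= t -> f 0 <= f t.
Proof.
move=> fl l0 t t0.
have c : {within `[0, +oo[, continuous f}.
  apply: derivable_within_continuous => x; rewrite in_itv /= andbT => x0.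
  by have [] := fl x x0.
apply: (ger0_derive1_ndecry _ _ c) => // x; rewrite in_itv /= andbT => /ltW x0.
  by have [] := fl x x0.
by rewrite derive1E; have [_ ->] := fl x x0; exact: l0.
Qed.

Lemma constant_ge0 (R : realType) (f : R -> R) :
  (forall t : R, 0 <= t -> is_derive t 1 f 0) ->
  forall t : R, 0 <= t -> f t = f 0.
Proof.
move=> f0 t t0; apply/eqP; rewrite eq_le (nondecreasing_ge0 f0)// andbT.
rewrite -lerN2; apply: (@nondecreasing_ge0 _ (- f) (fun=> 0)) => // s s0.
by rewrite -[0]oppr0; apply: is_deriveN; exact: f0.
Qed.

(** * The Ricci flow as a system of ordinary differential equations *)

Lemma metric_diag_gt0 (R : realType) (d : nat) (G : 'M[R]_d) i :
  is_metric_mx G -> 0 < G i i.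
Proof.
case=> _ /(_ (delta_mx 0 i)); rewrite -rowE trmx_delta -colE !mxE; apply.
apply/eqP => /rowP/(_ i)/eqP.
by rewrite !mxE !eqxx oner_eq0.
Qed.

(** The coframe at the neutral element is the coordinate one. *)
Lemma left_metric0 (R : realType) (n : nat) (G : 'M[R]_(n + n + 1)) :
  left_metric G 0 = G.
Proof.
have theta0 I : theta (0 : 'rV[R]_(n + n + 1)) I = delta_mx 0 I.
  rewrite /theta; case: ifP => _; last by rewrite subr0.
  by rewrite big1 ?subr0// => k _; rewrite mxE scale0r.
rewrite [RHS]matrix_sum_delta; apply: eq_bigr => I _; apply: eq_bigr => J _.
by rewrite !theta0 trmx_delta mul_delta_mx.
Qed.

Lemma has_deriv_ge0_linear (R : realType) (I : finType) (f : R -> I -> R)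
    (l : I -> R) (e : I -> R) (t : R) :
  (forall i, has_deriv_ge0 (f ^~ i) t (l i)) ->
  has_deriv_ge0 (fun s => \sum_i f s i * e i) t (\sum_i l i * e i).
Proof.
move=> fl; rewrite /has_deriv_ge0.
have -> : (fun s => (\sum_i f s i * e i - \sum_i f t i * e i) / (s - t)) =
    (fun s => \sum_i (f s i - f t i) / (s - t) * e i).
  apply/funext => s; rewrite -sumrB mulr_suml; apply: eq_bigr => i _.
  by rewrite -mulrBl mulrAC.
apply: cvg_big; first exact: add_continuous.
by move=> i _; apply: cvgMl; exact: fl.
Qed.

Section RicciFlowODE.
Variables (R : realType) (n : nat).

Definition heis_ode (a b : R -> 'rV[R]_n) (c : R -> R) (t : R) : Prop :=
  [/\ forall k, has_deriv_ge0 (fun s => a s 0 k) t (c t / b t 0 k),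
      forall k, has_deriv_ge0 (fun s => b s 0 k) t (c t / a t 0 k)
    & has_deriv_ge0 c t (- c t ^+ 2 * \sum_k (a t 0 k * b t 0 k)^-1)].

Definition heis_pos (a b : 'rV[R]_n) (c : R) : Prop :=
  [/\ forall k, 0 < a 0 k, forall k, 0 < b 0 k & 0 < c].

Lemma heis_diag_metric (a b : 'rV[R]_n) (c : R) :
  heis_pos a b c ->
  is_metric_mx (heis_diag a b c) /\ is_diag_mx (heis_diag a b c).
Proof.
move=> [a0 b0 c0]; split; last exact: diag_mx_is_diag.
split=> [|v v0]; first exact: tr_diag_mx.
have d0 I : 0 < heis_diag a b c I I.
  by elim/heis_ind: I => [k|k|]; rewrite heis_diagE.
have -> : (v *m heis_diag a b c *m v^T) 0 0 =
    \sum_I heis_diag a b c I I * v 0 I ^+ 2.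
  rewrite mxE; apply: eq_bigr => I _.
  by rewrite mul_mx_diag !mxE eqxx mulr1n; ring.
have [I vI] : exists I, v 0 I != 0.
  apply/existsP; apply: contraNT v0; rewrite negb_exists => /forallP H.
  by apply/eqP/rowP => I; rewrite mxE; apply/eqP; move/negPn: (H I).
rewrite (bigD1 I)//= ltr_wpDr//.
  by apply: sumr_ge0 => J _; rewrite mulr_ge0 ?sqr_ge0// ltW.
by rewrite mulr_gt0// exprn_even_gt0.
Qed.

Lemma left_metric_heis_diagE (a b : 'rV[R]_n) c x i j :
  left_metric (heis_diag a b c) x i j =
  \sum_I heis_diag a b c I I * (theta x I 0 i * theta x I 0 j).
Proof.
rewrite summxE; apply: eq_bigr => I _; rewrite summxE (bigD1 I)//=.
rewrite big1 => [|J JI]; last first.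
  by rewrite [heis_diag _ _ _ _ _]mxE eq_sym (negPf JI) mulr0n scale0r mxE.
by rewrite addr0 !mxE big_ord1 !mxE.
Qed.

(** The entries of a left-invariant metric at x are combinations of its
coefficients that do not depend on time, and at x = 0 they are these
coefficients; hence the flow equation at all points is equivalent to the
equation on the coefficients, which is the equation at the neutral element. *)
Lemma ricci_flow_ode (a b : R -> 'rV[R]_n) (c : R -> R) :
  (forall t : R, 0 <= t -> heis_pos (a t) (b t) (c t)) ->
  ricci_flow (fun t => left_metric (heis_diag (a t) (b t) (c t))) <->
  (forall t : R, 0 <= t -> heis_ode a b c t).
Proof.
move=> pos.
pose rc t := heis_diag (\row_k (- (c t / 2) / b t 0 k))
  (\row_k (- (c t / 2) / a t 0 k))
  (c t ^+ 2 / 2 * \sum_k (a t 0 k * b t 0 k)^-1).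
have rcE t x : 0 <= t -> ricci (left_metric (heis_diag (a t) (b t) (c t))) x =
    left_metric (rc t) x.
  move=> /pos[ap bp cp].
  by apply: ricci_heis_diag => [k|k|]; rewrite gt_eqF.
have eq_l f t l l' : l = l' -> has_deriv_ge0 f t l -> has_deriv_ge0 f t l'.
  by move=> <-.
split=> H t t0.
  have {}H I : has_deriv_ge0 (fun s => heis_diag (a s) (b s) (c s) I I) t
      (- 2 * rc t I I).
    have := H t t0 0 I I; rewrite rcE// left_metric0.
    by under eq_fun do rewrite left_metric0.
  have [ap bp cp] := pos t t0; split=> [k|k|].
  - have := H (xi k); under eq_fun do rewrite heis_diag_xi.
    rewrite /rc heis_diag_xi mxE; apply: eq_l.
    by field; rewrite gt_eqF.
  - have := H (yi k); under eq_fun do rewrite heis_diag_yi.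
    rewrite /rc heis_diag_yi mxE; apply: eq_l.
    by field; rewrite gt_eqF.
  - have := H zi; under eq_fun do rewrite heis_diag_zi.
    by rewrite /rc heis_diag_zi; apply: eq_l; field.
move=> x i j; rewrite rcE// left_metric_heis_diagE.
under eq_fun do rewrite left_metric_heis_diagE.
have -> : -2 * \sum_I rc t I I * (theta x I 0 i * theta x I 0 j) =
    \sum_I (-2 * rc t I I) * (theta x I 0 i * theta x I 0 j).
  by rewrite mulr_sumr; apply: eq_bigr => I _; rewrite [LHS]mulrA.
apply: (@has_deriv_ge0_linear _ _
  (fun s I => heis_diag (a s) (b s) (c s) I I)); have [Ha Hb Hc] := H t t0.
have [ap bp cp] := pos t t0.
apply: heis_ind => [k|k|].
- under eq_fun do rewrite heis_diag_xi.
  rewrite /rc heis_diag_xi mxE; apply: eq_l (Ha k).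
  by field; rewrite gt_eqF.
- under eq_fun do rewrite heis_diag_yi.
  rewrite /rc heis_diag_yi mxE; apply: eq_l (Hb k).
  by field; rewrite gt_eqF.
- under eq_fun do rewrite heis_diag_zi.
  by rewrite /rc heis_diag_zi; apply: eq_l Hc; field.
Qed.

End RicciFlowODE.

(** The continuation by tangent lines at time 0, applied to all the metric
coefficients at once. *)
Lemma heis_ode_extension (R : realType) (n : nat) (a b : R -> 'rV[R]_n)
    (c : R -> R) :
  (forall t : R, 0 <= t -> heis_pos (a t) (b t) (c t)) ->
  (forall t : R, 0 <= t -> heis_ode a b c t) ->
  exists a' b' : 'I_n -> R -> R, exists c' : R -> R,
  [/\ [/\ forall k (t : R), 0 <= t -> a' k t = a t 0 k,
          forall k (t : R), 0 <= t -> b' k t = b t 0 k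
        & forall t : R, 0 <= t -> c' t = c t],
      forall t : R, 0 <= t ->
        [/\ forall k, 0 < a' k t, forall k, 0 < b' k t & 0 < c' t],
      forall k (t : R), 0 <= t -> is_derive t 1 (a' k) (c' t / b' k t),
      forall k (t : R), 0 <= t -> is_derive t 1 (b' k) (c' t / a' k t)
    & forall t : R, 0 <= t ->
        is_derive t 1 c' (- c' t ^+ 2 * \sum_k (a' k t * b' k t)^-1)].
Proof.
move=> pos ode.
have /choice[a' /all_and2[a'E da']] k : exists F : R -> R,
    (forall t : R, 0 <= t -> F t = a t 0 k) /\
    (forall t : R, 0 <= t -> is_derive t 1 F (c t / b t 0 k)).
  have [|F ? ?] := @has_deriv_ge0_extension _ (fun s => a s 0 k)
    (fun t => c t / b t 0 k); last by exists F.
  by move=> t t0; case: (ode t t0).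
have /choice[b' /all_and2[b'E db']] k : exists F : R -> R,
    (forall t : R, 0 <= t -> F t = b t 0 k) /\
    (forall t : R, 0 <= t -> is_derive t 1 F (c t / a t 0 k)).
  have [|F ? ?] := @has_deriv_ge0_extension _ (fun s => b s 0 k)
    (fun t => c t / a t 0 k); last by exists F.
  by move=> t t0; case: (ode t t0).
have [|c' c'E dc'] := @has_deriv_ge0_extension _ c
    (fun t => - c t ^+ 2 * \sum_k (a t 0 k * b t 0 k)^-1).
  by move=> t t0; case: (ode t t0).
exists a', b', c'; split=> // [t t0|k t t0|k t t0|t t0].
- by have [? ? ?] := pos t t0; split=> [k|k|]; rewrite ?a'E ?b'E ?c'E.
- by rewrite c'E// b'E//; exact: da'.
- by rewrite c'E// a'E//; exact: db'.
- rewrite c'E//; under eq_bigr do rewrite a'E// b'E//.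
  exact: dc'.
Qed.

(** * Asymptotics of the solutions *)

Lemma powR_sqr (R : realType) (x r : R) : (x `^ r) ^+ 2 = x `^ (r * 2).
Proof. by rewrite -powR_mulrn ?powR_ge0// -powRrM. Qed.

Section Asymptotics.
Variables (R : realType) (n : nat) (n_gt0 : (0 < n)%N).
Implicit Types (k : 'I_n) (t u M : R).
Variables (a b : 'I_n -> R -> R) (c : R -> R).
Hypotheses (a_gt0 : forall k t, 0 <= t -> 0 < a k t)
           (b_gt0 : forall k t, 0 <= t -> 0 < b k t)
           (c_gt0 : forall t, 0 <= t -> 0 < c t).
Hypotheses
  (da : forall k t, 0 <= t -> is_derive t 1 (a k) (c t / b k t))
  (db : forall k t, 0 <= t -> is_derive t 1 (b k) (c t / a k t))
  (dc : forall t, 0 <= t ->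
     is_derive t 1 c (- c t ^+ 2 * \sum_k (a k t * b k t)^-1)).

Let p k t := a k t * b k t.
Let C := (\prod_k p k 0) * c 0 ^+ 2.
Let m : R := n.+2%:R.

Let p_gt0 k t : 0 <= t -> 0 < p k t.
Proof. by move=> t0; rewrite mulr_gt0 ?a_gt0 ?b_gt0. Qed.

Let dp k t : 0 <= t -> is_derive t 1 (p k) (2 * c t).
Proof.
move=> t0; have dak := da k t0; have dbk := db k t0.
have a0 := a_gt0 k t0; have b0 := b_gt0 k t0.
apply: (is_derive_eq (is_deriveM dak dbk)); rewrite /GRing.scale /=.
by field; rewrite !gt_eqF.
Qed.

Lemma heis_ratio_constant k t : 0 <= t -> a k t / b k t = a k 0 / b k 0.
Proof.
move: t; apply: (@constant_ge0 _ (fun t => a k t / b k t)) => t t0.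
have dak := da k t0; have dbk := db k t0.
have a0 := a_gt0 k t0; have b0 := b_gt0 k t0.
have dV := is_deriveV (lt0r_neq0 b0) dbk.
apply: (is_derive_eq (is_deriveM dak dV)); rewrite /GRing.scale /=.
by field; rewrite !gt_eqF.
Qed.

(** The logarithmic derivative of the product of the p k is 2 c times the sum
of the inverses of the p k, and that of c^2 is its opposite. *)
Lemma heis_first_integral t : 0 <= t -> (\prod_k p k t) * c t ^+ 2 = C.
Proof.
move=> t0.
pose F := \sum_(k < n) (@ln R \o p k) + (@ln R \o c) + (@ln R \o c).
have dF (s : R) : 0 <= s -> is_derive s 1 F 0.
  move=> s0; have cs := c_gt0 s0.
  have dl k : is_derive s 1 (@ln R \o p k) ((p k s)^-1 * (2 * c s)).
    by apply: is_derive1_comp; [exact/is_derive1_ln/p_gt0|exact: dp].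
  have dlc : is_derive s 1 (@ln R \o c)
      ((c s)^-1 * (- c s ^+ 2 * \sum_k (a k s * b k s)^-1)).
    by apply: is_derive1_comp; [exact: is_derive1_ln|exact: dc].
  have ds := is_derive_sum dl.
  apply: (is_derive_eq (is_deriveD (is_deriveD ds dlc) dlc)).
  rewrite -mulr_suml -/p; set S := \sum_k _.
  by rewrite -/S; field; rewrite gt_eqF.
have FE (s : R) : 0 <= s -> expR (F s) = (\prod_k p k s) * c s ^+ 2.
  move=> s0; rewrite /F /= !fctE expRD expRD lnK ?posrE ?c_gt0//.
  rewrite expr2 mulrA; congr (_ * _ * _).
  rewrite (_ : \sum_(k < n) _ = fun s => \sum_k ln (p k s)); last first.
    by apply/funext => u; rewrite fct_sumE.
  rewrite expR_sum; apply: eq_bigr => k _.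
  by rewrite lnK ?posrE ?p_gt0.
by rewrite -FE// (constant_ge0 dF t0) FE.
Qed.

Let C_gt0 : 0 < C.
Proof.
by rewrite mulr_gt0 ?exprn_gt0 ?c_gt0// prodr_gt0// => k _; rewrite p_gt0.
Qed.

(* Since all the p k have the same derivative 2 c, their increment s does not
   depend on k. *)
Let k0 : 'I_n := Ordinal n_gt0.
Let s t := p k0 t - p k0 0.

Let s_0 : s 0 = 0. Proof. exact: subrr. Qed.

Let ds t : 0 <= t -> is_derive t 1 s (2 * c t).
Proof.
move=> t0; have dpt := dp k0 t0.
by apply: (is_derive_eq (is_deriveB dpt (is_derive_cst _ _ _))); rewrite subr0.
Qed.

Let pE k t : 0 <= t -> p k t = p k 0 + s t.
Proof.
move=> t0; suff : p k t - s t = p k 0 - s 0.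
  by rewrite s_0 subr0 => <-; rewrite subrK.
apply: (@constant_ge0 _ (p k - s)) => // u u0.
by apply: (is_derive_eq (is_deriveB (dp k u0) (ds u0))); rewrite subrr.
Qed.

Let s_ge0 t : 0 <= t -> 0 <= s t.
Proof.
move=> t0; rewrite -s_0; apply: (nondecreasing_ge0 ds) => // u u0.
by rewrite mulr_ge0// ltW// c_gt0.
Qed.

Let m_gt0 : 0 < m. Proof. exact: ltr0n. Qed.

Let K := Num.sqrt C.
Let K_gt0 : 0 < K. Proof. by rewrite sqrtr_gt0. Qed.

(** By the first integral, c = K / sqrt (prod_k p k). If the p k were all equal
to s + M, the derivative (n + 2) (s + M)^(n/2) c of (s + M)^((n+2)/2) would be the
constant m K; choosing M above or below all the initial values p k 0 turns this
into a lower or an upper bound. *)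
Let dpow M t : 0 < M -> 0 <= t ->
  is_derive t 1 (fun u => (s u + M) `^ (m / 2))
    (m * ((s t + M) `^ (n%:R / 2) * c t)).
Proof.
move=> M0 t0.
have sM : 0 < s t + M by rewrite ltr_wpDl ?s_ge0.
have dsM : is_derive t 1 (fun u => s u + M) (2 * c t).
  apply: (is_derive_eq (is_deriveD (ds t0) (is_derive_cst M _ _))).
  by rewrite addr0.
have dw : is_derive t 1 (fun u => (s u + M) `^ (m / 2))
    (m / 2 * (s t + M) `^ (m / 2 - 1) * (2 * c t)).
  have dx := is_derive1_powR (m / 2) sM.
  exact: (@is_derive1_comp _ (fun x => x `^ (m / 2)) (fun u => s u + M)
    t _ _ dx dsM).
apply: (is_derive_eq dw).
have -> : m / 2 - 1 = n%:R / 2 by rewrite /m -addn2 natrD; field.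
by field.
Qed.

Let pow_c M t : 0 < M -> 0 <= t ->
  ((s t + M) `^ (n%:R / 2) * c t) ^+ 2 = (\prod_(k < n) (s t + M)) * c t ^+ 2.
Proof.
move=> M0 t0; rewrite exprMn powR_sqr divfK// powR_mulrn.
  by rewrite prodr_const card_ord.
by rewrite addr_ge0 ?s_ge0// ltW.
Qed.

Let lower M t : 0 < M -> (forall k, p k 0 <= M) -> 0 <= t ->
  m * K * t <= (s t + M) `^ (m / 2).
Proof.
move=> M0 pM t0; rewrite -subr_ge0.
pose F := (fun u => (s u + M) `^ (m / 2)) - (fun u => m * K * u).
have dF u : 0 <= u -> is_derive u 1 F
    (m * ((s u + M) `^ (n%:R / 2) * c u) - m * K).
  move=> u0; apply: (is_derive_eq (is_deriveB (dpow M0 u0)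
    (is_deriveZ (m * K) (is_derive_id u 1)))).
  by rewrite [_ *: _]mulr1.
apply: (le_trans (y := F 0)).
  by rewrite /F !fctE mulr0 subr0 powR_ge0.
apply: (nondecreasing_ge0 dF) => // u u0.
rewrite -mulrBr pmulr_rge0// subr_ge0 -(ler_pXn2r (_ : 0 < 2)%N) ?nnegrE//.
- rewrite pow_c// sqr_sqrtr ?(ltW C_gt0)// -(heis_first_integral u0).
  rewrite ler_wpM2r ?sqr_ge0// ler_prod// => k _.
  by rewrite ltW ?p_gt0//= pE// addrC lerD2l.
- by rewrite ltW.
- by rewrite mulr_ge0 ?powR_ge0// ltW// c_gt0.
Qed.

Let upper M t : 0 < M -> (forall k, M <= p k 0) -> 0 <= t ->
  (s t + M) `^ (m / 2) <= M `^ (m / 2) + m * K * t.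
Proof.
move=> M0 pM t0; rewrite -lerBlDr.
pose F := (fun u => m * K * u) - (fun u => (s u + M) `^ (m / 2)).
have dF u : 0 <= u -> is_derive u 1 F
    (m * K - m * ((s u + M) `^ (n%:R / 2) * c u)).
  move=> u0; apply: (is_derive_eq (is_deriveB
    (is_deriveZ (m * K) (is_derive_id u 1)) (dpow M0 u0))).
  by rewrite [_ *: _]mulr1.
have : F 0 <= F t.
  apply: (nondecreasing_ge0 dF) => // u u0.
  rewrite -mulrBr pmulr_rge0// subr_ge0 -(ler_pXn2r (_ : 0 < 2)%N) ?nnegrE//.
  - rewrite pow_c// sqr_sqrtr ?(ltW C_gt0)// -(heis_first_integral u0).
    rewrite ler_wpM2r ?sqr_ge0// ler_prod// => k _.
    by rewrite addr_ge0 ?s_ge0// ?(ltW M0)//= pE// addrC lerD2r.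
  - by rewrite mulr_ge0 ?powR_ge0// ltW// c_gt0.
  - by rewrite ltW.
have -> : F 0 = - M `^ (m / 2).
  by rewrite /F !fctE s_0 add0r mulr0 sub0r.
rewrite (_ : F t = m * K * t - (s t + M) `^ (m / 2)) //; lra.
Qed.

Let e : R := 2 / m.
(* q is the common equivalent of all the products p k. *)
Let q t := (m * K * t) `^ e.

Let e_gt0 : 0 < e. Proof. by rewrite divr_gt0. Qed.

Let mK_gt0 : 0 < m * K. Proof. exact: mulr_gt0. Qed.

Let q_gt0 t : 0 < t -> 0 < q t.
Proof. by move=> t0; rewrite powR_gt0// mulr_gt0. Qed.

Let powK (x : R) : 0 <= x -> (x `^ (m / 2)) `^ e = x.
Proof.
move=> x0; rewrite -powRrM (_ : m / 2 * e = 1) ?powRr1// /e.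
by field; rewrite gt_eqF.
Qed.

Let qV_cvg0 : (q t)^-1 @[t --> +oo] --> 0.
Proof.
apply/gtr0_cvgV0.
  by near=> t; apply: q_gt0; near: t; exact: nbhs_pinfty_gt.
apply/cvgryPge => A; near=> t.
have A0 : A <= Num.max A 0 by rewrite le_max lexx.
apply: le_trans A0 _; rewrite -[leLHS]powK ?le_max ?lexx ?orbT//.
rewrite ge0_ler_powR ?(ltW e_gt0)// ?nnegrE ?powR_ge0//.
  rewrite mulr_ge0 ?(ltW mK_gt0)//; near: t; exact: nbhs_pinfty_gt.
rewrite -ler_pdivrMl//; near: t; exact: nbhs_pinfty_ge.
Unshelve. all: by end_near.
Qed.

(** Squeeze p k between the bounds for M1, the sum of the p j 0, and for M2,
the inverse of the sum of their inverses. *)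
Let p_equiv k : p k t / q t @[t --> +oo] --> (1 : R).
Proof.
pose M1 := \sum_j p j 0; pose M2 := (\sum_j (p j 0)^-1)^-1.
have M1p j : p j 0 <= M1.
  by rewrite /M1 (bigD1 j)//= lerDl sumr_ge0// => i _; rewrite ltW ?p_gt0.
have M1_gt0 : 0 < M1 by apply: lt_le_trans (M1p k0); exact: p_gt0.
have Vp j : (p j 0)^-1 <= \sum_j (p j 0)^-1.
  rewrite (bigD1 j)//= lerDl sumr_ge0// => i _.
  by rewrite invr_ge0 ltW ?p_gt0.
have sV : 0 < \sum_j (p j 0)^-1.
  by apply: lt_le_trans (Vp k0); rewrite invr_gt0 p_gt0.
have M2_gt0 : 0 < M2 by rewrite invr_gt0.
have M2p j : M2 <= p j 0.
  by rewrite /M2 -[leRHS]invrK lef_pV2 ?posrE ?invr_gt0 ?p_gt0.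
pose L := M2 `^ (m / 2) / (m * K).
have lowq : \forall t \near +oo, 1 + (p k 0 - M1) * (q t)^-1 <= p k t / q t <=
    (1 + L * t^-1) `^ e + (p k 0 - M2) * (q t)^-1.
  near=> t.
  have t0 : 0 < t by near: t; exact: nbhs_pinfty_gt.
  have qt := q_gt0 t0; rewrite (pE k (ltW t0)).
  have sM1 : 0 <= s t + M1 := addr_ge0 (s_ge0 (ltW t0)) (ltW M1_gt0).
  have sM2 : 0 <= s t + M2 := addr_ge0 (s_ge0 (ltW t0)) (ltW M2_gt0).
  apply/andP; split.
    rewrite -[1](mulfV (lt0r_neq0 qt)) -mulrDl ler_pM2r ?invr_gt0//.
    have : q t <= s t + M1.
      rewrite -[leRHS]powK//.
      rewrite ge0_ler_powR ?(ltW e_gt0)// ?nnegrE ?powR_ge0//.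
        by rewrite mulr_ge0 ?(ltW mK_gt0) ?(ltW t0).
      by apply: lower => //; exact: ltW.
    lra.
  have -> : (1 + L * t^-1) `^ e = (M2 `^ (m / 2) + m * K * t) `^ e / q t.
    apply: (canRL (mulfK (lt0r_neq0 qt))).
    have mKt : 0 <= m * K * t by rewrite mulr_ge0 ?(ltW mK_gt0) ?(ltW t0).
    have L0 : 0 <= L by rewrite divr_ge0 ?powR_ge0 ?(ltW mK_gt0).
    have LV : 0 <= 1 + L * t^-1.
      by rewrite addr_ge0// mulr_ge0// invr_ge0 (ltW t0).
    rewrite /q -powRM//.
    congr (_ `^ _); rewrite /L; field.
    by rewrite !gt_eqF.
  rewrite -mulrDl ler_pM2r ?invr_gt0//.
  have : s t + M2 <= (M2 `^ (m / 2) + m * K * t) `^ e.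
    rewrite -[leLHS]powK//.
    rewrite ge0_ler_powR ?(ltW e_gt0)// ?nnegrE ?powR_ge0//.
      by rewrite addr_ge0 ?powR_ge0// mulr_ge0 ?(ltW mK_gt0) ?(ltW t0).
    by apply: upper => //; exact: ltW.
  lra.
have cq M : M * (q t)^-1 @[t --> +oo] --> 0.
  by rewrite -[X in _ --> X](mulr0 M); apply: cvgMr.
apply: (squeeze_cvgr lowq).
  by rewrite -[X in _ --> X]addr0; apply: cvgD; [exact: cvg_cst|exact: cq].
rewrite -[X in _ --> X]addr0; apply: cvgD; last exact: cq.
have tV : t^-1 @[t --> (+oo : set_system R)] --> 0.
  apply/gtr0_cvgV0; first exact: nbhs_pinfty_gt.
  exact: cvg_id.
have cL : 1 + L * t^-1 @[t --> +oo] --> (1 : R).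
  rewrite -[X in _ --> X]addr0 -[X in _ + X](mulr0 L).
  by apply: cvgD; [exact: cvg_cst|exact: cvgMr].
rewrite -[X in _ --> X](_ : 1 `^ e = 1); last by rewrite powR1.
apply: (cvg_comp (fun t => 1 + L * t^-1) (fun x => x `^ e) cL).
have [+ _] := is_derive1_powR e (ltr01 : 0 < (1 : R)).
by move=> /derivable1_diffP/differentiable_continuous.
Unshelve. all: by end_near.
Qed.

(** Comparing squares turns the square roots and half powers of the expected
equivalents into rational expressions in q. *)
Let asymp_sqr (f g : R -> R) :
  (forall t, 0 < t -> 0 < f t) -> (forall t, 0 < t -> 0 < g t) ->
  f t ^+ 2 / g t ^+ 2 @[t --> +oo] --> (1 : R) -> asymp f g.
Proof.
move=> f0 g0 fg; rewrite /asymp -[X in _ --> X]sqrtr1.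
have := cvg_comp _ _ fg (@sqrt_continuous R 1); apply: cvg_trans.
apply: near_eq_cvg; near=> t.
have t0 : 0 < t by near: t; exact: nbhs_pinfty_gt.
rewrite /= -expr_div_n sqrtr_sqr ger0_norm// divr_ge0// ltW//.
  exact: f0.
exact: g0.
Unshelve. all: by end_near.
Qed.

Let qE t : 0 < t -> q t = m `^ e * C `^ (2^-1 * e) * t `^ e.
Proof.
move=> t0; rewrite /q /K -powR12_sqrt ?(ltW C_gt0)//.
move: C m e (ltW m_gt0) => D m' e' m'0; rewrite powRrM.
by rewrite !powRM ?mulr_ge0 ?powR_ge0 ?(ltW t0).
Qed.

Let coef_sqr (A : R) t : 0 < A -> 0 < t ->
  (m `^ (1 / m) * Num.sqrt A * C `^ (1 / (2 * m)) * t `^ (1 / m)) ^+ 2 =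
  A * q t.
Proof.
move=> A0 t0; rewrite !exprMn !powR_sqr sqr_sqrtr ?(ltW A0)//.
rewrite (qE t0) /e (_ : 1 / m * 2 = 2 / m); last by field; rewrite gt_eqF.
rewrite (_ : 1 / (2 * m) * 2 = 2^-1 * (2 / m)); last by field; rewrite gt_eqF.
by rewrite -!mulrA [RHS]mulrCA.
Qed.

Let coef_gt0 (A : R) t : 0 < A -> 0 < t ->
  0 < m `^ (1 / m) * Num.sqrt A * C `^ (1 / (2 * m)) * t `^ (1 / m).
Proof. by move=> A0 t0; rewrite !mulr_gt0 ?powR_gt0 ?sqrtr_gt0. Qed.

(** By constancy of the ratio a / b, the square of a is (a 0 / b 0) p. *)
Lemma heis_asymp_a k : asymp (a k)
  (fun t => m `^ (1 / m) * Num.sqrt (a k 0 / b k 0) * C `^ (1 / (2 * m))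
            * t `^ (1 / m)).
Proof.
have A0 : 0 < a k 0 / b k 0 by rewrite divr_gt0 ?a_gt0 ?b_gt0.
apply: asymp_sqr => [t /ltW t0|t t0|]; [exact: a_gt0|exact: coef_gt0|].
apply: cvg_trans (@p_equiv k); apply: near_eq_cvg; near=> t.
have t0 : 0 < t by near: t; exact: nbhs_pinfty_gt.
have qt := q_gt0 t0.
have [at0 bt0] := (a_gt0 k (ltW t0), b_gt0 k (ltW t0)).
rewrite coef_sqr// -(heis_ratio_constant k (ltW t0)) /p.
by field; rewrite !gt_eqF.
Unshelve. all: by end_near.
Qed.

Lemma heis_asymp_b k : asymp (b k)
  (fun t => m `^ (1 / m) * Num.sqrt (b k 0 / a k 0) * C `^ (1 / (2 * m))
            * t `^ (1 / m)).
Proof.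
have A0 : 0 < b k 0 / a k 0 by rewrite divr_gt0 ?a_gt0 ?b_gt0.
apply: asymp_sqr => [t /ltW t0|t t0|]; [exact: b_gt0|exact: coef_gt0|].
apply: cvg_trans (@p_equiv k); apply: near_eq_cvg; near=> t.
have t0 : 0 < t by near: t; exact: nbhs_pinfty_gt.
have qt := q_gt0 t0.
have [at0 bt0] := (a_gt0 k (ltW t0), b_gt0 k (ltW t0)).
rewrite coef_sqr// -(invf_div (a k 0)) -(heis_ratio_constant k (ltW t0)) /p.
by field; rewrite !gt_eqF.
Unshelve. all: by end_near.
Qed.

(** The first integral gives c^2 = C / prod_k p k, and each p k is equivalent
to q. *)
Lemma heis_asymp_c : asymp c
  (fun t => m `^ (- (n%:R / m)) * C `^ (1 / m) * t `^ (- (n%:R / m))).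
Proof.
apply: asymp_sqr => [t /ltW t0|t t0|]; first exact: c_gt0.
  by rewrite !mulr_gt0 ?powR_gt0.
have rV : (\prod_k (p k t / q t)^-1) @[t --> +oo] --> (1 : R).
  rewrite -[X in _ --> X](_ : \prod_(k < n) (1 : R)^-1 = 1); last first.
    by rewrite big1// => k _; rewrite invr1.
  apply: cvg_big; first exact: mul_continuous.
  by move=> k _; apply: cvgV; [exact: oner_neq0|exact: p_equiv].
apply: cvg_trans rV; apply: near_eq_cvg; near=> t.
have t0 : 0 < t by near: t; exact: nbhs_pinfty_gt.
have qt := q_gt0 t0.
have prodE : \prod_k (p k t / q t)^-1 = q t ^+ n / \prod_k p k t.
  under eq_bigr do rewrite invf_div.
  by rewrite prodf_div prodr_const card_ord.
have P0 : 0 < \prod_k p k t.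
  by apply: prodr_gt0 => k _; exact/p_gt0/ltW.
rewrite /= prodE.
set D := _ * t `^ _.
have DE : D ^+ 2 * q t ^+ n = C.
  rewrite (qE t0) /D !exprMn !powR_sqr -!powR_mulrn ?powR_ge0// -!powRrM.
  have neg (x : R) : 0 < x -> x `^ (- (n%:R / m) * 2) * x `^ (e * n%:R) = 1.
    move=> x0; rewrite -powRD; last by rewrite (gt_eqF x0) implybT.
    by rewrite (_ : _ + _ = 0) ?powRr0// /e; field; rewrite gt_eqF.
  have CC : C `^ (1 / m * 2) * C `^ (2^-1 * e * n%:R) = C.
    rewrite -powRD; last by rewrite (gt_eqF C_gt0) implybT.
    rewrite (_ : _ + _ = 1) ?powRr1 ?(ltW C_gt0)// /e /m -addn2 natrD.
    by field; rewrite -natrD gt_eqF// ltr0n addn2.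
  rewrite mulrACA (mulrACA (m `^ _)) neg// neg// CC.
  by rewrite mul1r mulr1.
have D0 : 0 < D by rewrite !mulr_gt0 ?powR_gt0.
have := heis_first_integral (ltW t0); rewrite -DE => E.
have -> : c t ^+ 2 = D ^+ 2 * q t ^+ n / \prod_k p k t.
  by rewrite -E mulrAC mulfV ?mul1r// gt_eqF.
by field; rewrite !gt_eqF.
Unshelve. all: by end_near.
Qed.

End Asymptotics.

(** * Existence of the flow *)

(** Separation of variables: s is the inverse function of the primitive F of
1 / v, shifted so that s 0 = 0. As 1 / v is bounded below, F is strictly
increasing and unbounded, hence s exists for all times. *)
Lemma autonomous_ode_solution (R : realType) (v : R -> R) (V : R) :
  continuous v -> (forall u, 0 < v u <= V) ->
  exists2 s : R -> R, s 0 = 0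
    & forall t : R, 0 <= t -> 0 <= s t /\ is_derive t 1 s (v (s t)).
Proof.
move=> cv vV.
have v0 u : 0 < v u by case/andP: (vV u).
have V0 : 0 < V by case/andP: (vV 0) => + ?; move/lt_le_trans; exact.
have cphi : continuous (fun u => (v u)^-1).
  by move=> u; apply: cvgV; [rewrite gt_eqF|exact: cv].
(* The integral starts at -1 so that 0 is an interior point of the domain. *)
pose F (x : R) := (\int[lebesgue_measure]_(u in `[(-1)%R, x]) (v u)^-1)%R.
have dF (x : R) : -1 < x -> is_derive x 1 F (v x)^-1.
  move=> x1.
  have [||Fx <-] := @continuous_FTC1_closed R (fun u => (v u)^-1) (-1) x (x + 1)
    _ _ x1 (cphi x).
  - by rewrite ltrDl.
  - apply: continuous_compact_integrable; first exact: segment_compact.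
    exact: continuous_subspaceT.
  - by rewrite derive1E; exact: DeriveDef.
have F_incr (x y : R) : -1 < x -> x <= y -> V^-1 * (y - x) <= F y - F x.
  move=> x1 xy.
  have [||z zxy ->] := @MVT_segment _ F (fun u => (v u)^-1) x y xy.
  - by move=> z; rewrite in_itv /= => /andP[xz _]; apply/dF/(lt_trans x1).
  - apply: derivable_within_continuous => z; rewrite in_itv /= => /andP[xz _].
    by have [] := dF z (lt_le_trans x1 xz).
  - rewrite ler_wpM2r ?subr_ge0// lef_pV2 ?posrE//.
    by case/andP: (vV z).
have F_inj (x y : R) : -1 < x -> -1 < y -> F x = F y -> x = y.
  wlog xy : x y / x <= y => [H x1 y1 E|x1 _ E].
    by case: (leP x y) => [/H|/ltW/H]; [exact|move=> ->].
  have := F_incr x y x1 xy; rewrite E subrr pmulr_rle0 ?invr_gt0// subr_le0.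
  by move=> yx; apply/eqP; rewrite eq_le xy.
pose g y := xget 0 [set x | -1 < x /\ F x = y].
have gK (x : R) : -1 < x -> g (F x) = x.
  by move=> x1; rewrite /g; case: xgetP => [z _ [z1 /F_inj->//]|/(_ x)[]].
have dg (x : R) : -1 < x -> is_derive (F x) 1 g (v x).
  move=> x1; rewrite -[v x]invrK; apply: is_derive_inverse (dF x x1) _.
  - by near=> z; apply: gK; near: z; exact: lt_nbhsr.
  - near=> z; have : -1 < z by near: z; exact: lt_nbhsr.
    by move=> /dF[+ _] => /derivable1_diffP/differentiable_continuous.
  - by rewrite invr_eq0 gt_eqF.
have N10 : -1 < 0 :> R by rewrite ltrN10.
exists (fun t => g (F 0 + t)); first by rewrite addr0 gK.
move=> t t0.
have [x x0 Fx] : exists2 x, 0 <= x & F x = F 0 + t.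
  have Vt : 0 <= V * t by rewrite mulr_ge0// ltW.
  have [||x] := @IVT _ F 0 (V * t) (F 0 + t) Vt.
  - apply: derivable_within_continuous => z; rewrite in_itv /= => /andP[z0 _].
    by have [] := dF z (lt_le_trans N10 z0).
  - have := F_incr 0 (V * t) N10 Vt; rewrite subr0 mulKf ?gt_eqF// => H.
    rewrite ge_min le_max lerDl t0 /=; apply/orP; right; lra.
  - by rewrite in_itv /= => /andP[x0 _] Fx; exists x.
have x1 : -1 < x by exact: lt_le_trans x0.
rewrite -Fx gK//; split=> //.
have := dg x x1; rewrite Fx => dgx.
have dt : is_derive t 1 (fun t => F 0 + t) 1.
  apply: (is_derive_eq (is_deriveD (is_derive_cst (F 0) t 1)
    (is_derive_id t 1))).
  by rewrite add0r.
have := @is_derive1_comp _ g (fun t => F 0 + t) t _ _ dgx dt.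
by rewrite mulr1.
Unshelve. all: by end_near.
Qed.

Section Existence.
Variables (R : realType) (n : nat) (a0 b0 : 'I_n -> R) (c0 : R).
Hypotheses (a0_gt0 : forall k, 0 < a0 k) (b0_gt0 : forall k, 0 < b0 k)
           (c0_gt0 : 0 < c0).

(** Along a solution, the increment s of all the products p k satisfies
s' = 2 c, where by the first integral c is the function G of s alone. The
solution s of this scalar equation determines the others: the ratio a / b is
constant and a b = p + s. *)
Lemma heis_ode_solution : exists a b : 'I_n -> R -> R, exists c : R -> R,
  [/\ forall k, a k 0 = a0 k, forall k, b k 0 = b0 k, c 0 = c0 &
  forall t : R, 0 <= t ->
  [/\ forall k, 0 < a k t /\ is_derive t 1 (a k) (c t / b k t),
      forall k, 0 < b k t /\ is_derive t 1 (b k) (c t / a k t)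
    & 0 < c t /\
      is_derive t 1 c (- c t ^+ 2 * \sum_k (a k t * b k t)^-1)]].
Proof.
pose p k := a0 k * b0 k.
have p0 k : 0 < p k by rewrite mulr_gt0.
pose G u := c0 * expR (- 2^-1 * \sum_k (ln (p k + u) - ln (p k))).
have G_gt0 u : 0 < G u by rewrite mulr_gt0 ?expR_gt0.
(* The absolute value makes v a bounded continuous function on the whole line;
   it disappears on the solution, which is nonnegative. *)
pose v (u : R) := 2 * G `|u|.
have cv : continuous v.
  move=> u; apply: cvgMr; apply: cvgMr; apply: continuous_comp; last first.
    exact: continuous_expR.
  apply: cvgMr; apply: cvg_big; first exact: add_continuous.
  move=> k _; apply: cvgB; last exact: cvg_cst.
  have pu : 0 < p k + `|u| by rewrite ltr_wpDr.
  apply: (cvg_comp (fun u => p k + `|u|) (@ln R)); last exact: continuous_ln.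
  by apply: cvgD; [exact: cvg_cst|exact: norm_continuous].
have vV u : 0 < v u <= 2 * c0.
  rewrite /v mulr_gt0//= ler_pM2l// -[leRHS]mulr1 ler_pM2l// -[leRHS]expR0.
  rewrite ler_expR mulNr oppr_le0 mulr_ge0// sumr_ge0// => k _.
  by rewrite subr_ge0 ler_ln ?posrE ?ltr_wpDr// lerDl.
have [s s0 sP] := autonomous_ode_solution cv vV.
pose a k t := Num.sqrt (a0 k / b0 k * (p k + s t)).
pose b k t := b0 k / a0 k * a k t.
pose c t := G (s t).
have a_init k : a k 0 = a0 k.
  rewrite /a s0 addr0 /p (_ : _ * _ = a0 k ^+ 2) ?sqrtr_sqr ?gtr0_norm//.
  by field; rewrite gt_eqF.
exists a, b, c; split=> [//|k||t t0].
- by rewrite /b a_init divfK// gt_eqF.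
- rewrite /c s0 /G big1 ?mulr0 ?expR0 ?mulr1// => k _.
  by rewrite addr0 subrr.
have [st ds] := sP t t0.
have {}ds : is_derive t 1 s (2 * c t).
  by apply: (is_derive_eq ds); rewrite /v ger0_norm.
have ps k : 0 < p k + s t by rewrite ltr_wpDr.
have dps k : is_derive t 1 (fun u => p k + s u) (2 * c t).
  apply: (is_derive_eq (is_deriveD (is_derive_cst (p k) t 1) ds)).
  by rewrite add0r.
have Aps k : 0 < a0 k / b0 k * (p k + s t) by rewrite mulr_gt0// divr_gt0.
have a_gt0 k : 0 < a k t by rewrite sqrtr_gt0.
have b_gt0 k : 0 < b k t by rewrite mulr_gt0// divr_gt0.
have da k : is_derive t 1 (a k) (c t / b k t).
  have dA : is_derive t 1 (fun u => a0 k / b0 k * (p k + s u))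
      (a0 k / b0 k * (2 * c t)).
    exact: is_deriveZ.
  have da := @is_derive1_comp _ Num.sqrt _ t _ _ (is_derive1_sqrt (Aps k)) dA.
  apply: (is_derive_eq da); rewrite /b -/(a k t).
  by field; rewrite !gt_eqF//; exact: a_gt0.
split=> [k|k|].
- by split.
- split=> //.
  apply: (is_derive_eq (is_deriveZ (b0 k / a0 k) (da k))).
  rewrite /GRing.scale /= /b; have := a_gt0 k => at0.
  by field; rewrite !gt_eqF.
split; first exact: G_gt0.
have dl k : is_derive t 1 (fun u => ln (p k + s u) - ln (p k))
    ((p k + s t)^-1 * (2 * c t)).
  have dln := @is_derive1_comp _ (@ln R) _ t _ _ (is_derive1_ln (ps k)) (dps k).
  by apply: (is_derive_eq (is_deriveB dln (is_derive_cst (ln (p k)) t 1)));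
    rewrite subr0.
have dS : is_derive t 1 (fun u => - 2^-1 * \sum_k (ln (p k + s u) - ln (p k)))
    (- 2^-1 * \sum_k ((p k + s t)^-1 * (2 * c t))).
  have := is_deriveZ (- 2^-1) (is_derive_sum dl).
  rewrite (_ : _ \*: _ =
    fun u => - 2^-1 * \sum_k (ln (p k + s u) - ln (p k)))//.
  by apply/funext => u; rewrite /= fct_sumE.
have dE := @is_derive1_comp _ (@expR R) _ t _ _ (is_derive_expR _) dS.
apply: (is_derive_eq (is_deriveZ c0 dE)).
rewrite [LHS]mulrA -/(G (s t)) -/(c t) -mulr_suml.
rewrite (eq_bigr (fun k => (a k t * b k t)^-1)); first by field.
move=> k _; congr (_^-1); rewrite /b mulrCA -expr2 sqr_sqrtr ?ltW//.
by field; rewrite !gt_eqF.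
Qed.

End Existence.

Lemma diagonal_solution_exists (R : realType) (n : nat)
    (G0 : 'M[R]_(n + n + 1)) : is_metric_mx G0 -> is_diag_mx G0 ->
  exists G : R -> 'M[R]_(n + n + 1), diagonal_solution G0 G.
Proof.
move=> mG0 dG0.
have [a [b [c [a0 b0 c0 H]]]] := heis_ode_solution
  (fun k : 'I_n => metric_diag_gt0 (xi k) mG0)
  (fun k : 'I_n => metric_diag_gt0 (yi k) mG0) (metric_diag_gt0 zi mG0).
pose A t : 'rV[R]_n := \row_k a k t; pose B t : 'rV[R]_n := \row_k b k t.
have pos t : 0 <= t -> heis_pos (A t) (B t) (c t).
  move=> /H[Ha Hb [Hc _]]; split=> // k; rewrite mxE; first by case: (Ha k).
  by case: (Hb k).
exists (fun t => heis_diag (A t) (B t) (c t)); split.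
- rewrite [RHS](is_diag_heis_diag dG0) c0.
  by congr heis_diag; apply/rowP => k; rewrite !mxE.
- by move=> t t0; apply: heis_diag_metric; exact: pos.
- apply/ricci_flow_ode => // t t0; have [Ha Hb [_ Hc]] := H t t0; split.
  + move=> k; under eq_fun do rewrite mxE.
    by rewrite mxE; apply: is_derive_has_deriv_ge0; case: (Ha k).
  + move=> k; under eq_fun do rewrite mxE.
    by rewrite mxE; apply: is_derive_has_deriv_ge0; case: (Hb k).
  + under eq_bigr do rewrite !mxE.
    exact: is_derive_has_deriv_ge0.
Qed.

(** * The asymptotic behaviour *)

Lemma eq_asymp (R : realType) (f g h : R -> R) :
  (forall t : R, 0 <= t -> f t = g t) -> asymp f h -> asymp g h.
Proof.
move=> fg; apply: cvg_trans; apply: near_eq_cvg; near=> t.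
by rewrite fg//; near: t; exact: nbhs_pinfty_ge.
Unshelve. all: by end_near.
Qed.

Theorem mainTheorem3 (R : realType) (n : nat) (hn : (1 <= n)%N)
    (G0 : 'M[R]_(n + n + 1)) (hG0 : is_metric_mx G0) (dG0 : is_diag_mx G0) :
  (exists G : R -> 'M[R]_(n + n + 1), diagonal_solution G0 G) /\
  forall G : R -> 'M[R]_(n + n + 1), diagonal_solution G0 G ->
    let g (t : R) (I : 'I_(n + n + 1)) : R := G t I I in
    let A (i : 'I_n) : R := g 0 (xi i) / g 0 (yi i) in
    let B (i : 'I_n) : R := g 0 (yi i) / g 0 (xi i) in
    let C : R :=
      (\prod_(I < n + n) g 0 (lshift 1 I)) * g 0 zi ^+ 2 in
    let m : R := n.+2%:R in
    [/\ forall i : 'I_n,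
          asymp (fun t => g t (xi i))
            (fun t => m `^ (1 / m) * Num.sqrt (A i) * C `^ (1 / (2 * m))
                      * t `^ (1 / m)),
        forall i : 'I_n,
          asymp (fun t => g t (yi i))
            (fun t => m `^ (1 / m) * Num.sqrt (B i) * C `^ (1 / (2 * m))
                      * t `^ (1 / m))
      & asymp (fun t => g t zi)
            (fun t => m `^ (- (n%:R / m)) * C `^ (1 / m)
                      * t `^ (- (n%:R / m)))].
Proof.
split; first exact: diagonal_solution_exists.
move=> G [_ metricG flowG] g A B C m.
pose a t : 'rV[R]_n := \row_k G t (xi k) (xi k).
pose b t : 'rV[R]_n := \row_k G t (yi k) (yi k).
pose c t : R := G t zi zi.
have pos t : 0 <= t -> heis_pos (a t) (b t) (c t).
  move=> /metricG[mG _].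
  by split=> [k|k|]; rewrite ?mxE; exact: metric_diag_gt0.
have ode : forall t : R, 0 <= t -> heis_ode a b c t.
  apply/(ricci_flow_ode pos) => t t0 x i j.
  have GE s : 0 <= s -> G s = heis_diag (a s) (b s) (c s).
    by move=> /metricG[_]; exact: is_diag_heis_diag.
  rewrite -(GE t t0); apply: eq_has_deriv_ge0 (flowG t t0 x i j) => // s s0.
  by rewrite -GE.
have [a' [b' [c' [[a'E b'E c'E] posE da' db' dc']]]] :=
  heis_ode_extension pos ode.
have a'_gt0 k (t : R) : 0 <= t -> 0 < a' k t by case/posE.
have b'_gt0 k (t : R) : 0 <= t -> 0 < b' k t by case/posE.
have c'_gt0 (t : R) : 0 <= t -> 0 < c' t by case/posE.
have a'g k (t : R) : 0 <= t -> a' k t = g t (xi k).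
  by move=> t0; rewrite a'E// mxE.
have b'g k (t : R) : 0 <= t -> b' k t = g t (yi k).
  by move=> t0; rewrite b'E// mxE.
have CE : (\prod_k (a' k 0 * b' k 0)) * c' 0 ^+ 2 = C.
  rewrite /C big_split_ord /= -big_split /= c'E//; congr (_ * _).
  by apply: eq_bigr => k _; rewrite a'g// b'g.
split=> [i|i|].
- rewrite /A -a'g// -b'g// -CE.
  apply: eq_asymp (heis_asymp_a hn a'_gt0 b'_gt0 c'_gt0 da' db' dc' i).
  by move=> t /a'g.
- rewrite /B -a'g// -b'g// -CE.
  apply: eq_asymp (heis_asymp_b hn a'_gt0 b'_gt0 c'_gt0 da' db' dc' i).
  by move=> t /b'g.
- rewrite -CE.
  by apply: eq_asymp (heis_asymp_c hn a'_gt0 b'_gt0 c'_gt0 da' db' dc').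
Qed.
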